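(* Let $\lambda_0>0$, $g(\mathbf W):=\frac12\|\mathbf W_1\mathbf W_2\cdots\mathbf W_N\mathbf X-\mathbf Y\|_F^2$, $f(\mathbf W):=\frac{\lambda_0}2\sum_{i=1}^N\|\mathbf W_i\|_F^2$, and let $h$ be the kernel specified in the context. Consider the BPG iteration $\mathbf W^{\mathbf{k+1}}\in T_\lambda(\mathbf W^{\mathbf k})$, and denote $\mathbf P_i^k:=\lambda\nabla_{\mathbf W_i}g(\mathbf W^{\mathbf k})-\nabla_{\mathbf W_i}h(\mathbf W^{\mathbf k})$ and $\|\mathbf P\|_F:=\sqrt{\sum_{i=1}^N\|\mathbf P_i^k\|_F^2}$. Then the update steps in each iteration are given by $$\mathbf W_i^{k+1}=-r\,\frac{\sqrt N\,\mathbf P_i^k}{\|\mathbf P\|_F}\qquad\text{for all } i\in\{1,\dots,N\},$$ where $r$ is the non-negative real root of (a) for $N=2$: $$2c_1(2)r^3+(c_2(2)+\lambda\lambda_0)r-\frac{\sqrt{\sum_{i=1}^2\|\mathbf P_i^k\|_F^2}}{\sqrt2}=0;$$ (b) for $N>2$ even: $$2c_1(N)r^{2N-1}+c_2(N)r^{N-1}+\left(\frac{2\rho}N+\lambda\lambda_0\right)r-\frac{\sqrt{\sum_{i=1}^N\|\mathbf P_i^k\|_F^2}}{\sqrt N}=0;$$ (c) for $N>2$ odd: $$2c_1(N)r^{2N-1}+c_3(N)\left(\frac{Nr^2+1}{N+1}\right)^{\frac{N-1}2}r+\left(\frac{2\rho}N+\lambda\lambda_0\right)r-\frac{\sqrt{\sum_{i=1}^N\|\mathbf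 P_i^k\|_F^2}}{\sqrt N}=0.$$
   Context: Setting: $N\ge2$ is an integer, $d_1,\dots,d_N,d,n_T$ are positive integers, $d_{N+1}:=d$, $\mathcal W_i:=\mathbb R^{d_i\times d_{i+1}}$, $\mathcal W:=\mathcal W_1\times\cdots\times\mathcal W_N$, with elements $\mathbf W=(\mathbf W_1,\dots,\mathbf W_N)$ and $\|\mathbf W\|_F^2:=\sum_{i=1}^N\|\mathbf W_i\|_F^2$. The matrices $\mathbf X\in\mathbb R^{d\times n_T}$, $\mathbf Y\in\mathbb R^{d_1\times n_T}$ are fixed. Constants and kernels: $c_1(N)=\frac{(2N-1)N^N}{2N!}\|\mathbf X\|_F^2$; for even $N$, $c_2(N)=\frac{\|\mathbf Y\|_F\|\mathbf X\|_F(N-1)N^{(N-2)/2}}{(N-2)^{(N-2)/2}}$ (with $0^0=1$ for $N=2$); for odd $N$, $c_3(N)=\frac{\|\mathbf Y\|_F\|\mathbf X\|_F(N-1)(N+1)^{(N-1)/2}}{(N-1)^{(N-1)/2}}$. $H_1(\mathbf W)=\left(\frac{\|\mathbf W\|_F^2}{N}\right)^N$, $H_2(\mathbf W)=\left(\frac{\|\mathbf W\|_F^2}{N}\right)^{N/2}$, $H_3(\mathbf W)=\left(\frac{\|\mathbf W\|_F^2+1}{N+1}\right)^{(N+1)/2}$, $H_4(\mathbf W)=\frac{\|\mathbf W\|_F^2}{N}$. The kernel $h$ is: for $N=2$, $h=c_1(2)H_1+c_2(2)H_2$; for even $N>2$, $h=c_1(N)H_1+c_2(N)H_2+\rho H_4$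 with a fixed $\rho>0$; for odd $N>2$, $h=c_1(N)H_1+c_3(N)H_3+\rho H_4$ with a fixed $\rho\ge0$. It is a standing assumption that $h$ is $\sigma$-strongly convex for some $\sigma>0$. Bregman distance: $D_h(u,x)=h(u)-h(x)-\langle\nabla h(x),u-x\rangle$. BPG (Bregman Proximal Gradient) for minimizing $f+g$: fix a step size $0<\lambda<1/L$, where $L>0$ is such that $Lh-g$ and $Lh+g$ are convex on $\mathcal W$; choose an initial point, and for each $k\ge1$ compute $\mathbf W^{\mathbf{k+1}}\in T_\lambda(\mathbf W^{\mathbf k})$, where $$T_\lambda(x):=\operatorname*{argmin}_{u}\left\{f(u)+\langle\nabla g(x),u\rangle+\tfrac1\lambda D_h(u,x)\right\}.$$ Convention: if $\|\mathbf P\|_F=0$, the update formula is read as $\mathbf W_i^{k+1}=0$ for all $i$. *)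

(* Defs.v *)
From HB Require Import structures.
From mathcomp Require Import all_boot all_order all_algebra.
From mathcomp Require Import boolp classical_sets functions reals.
From mathcomp Require Import topology normedtype derive convex.

Set Implicit Arguments.
Unset Strict Implicit.
Unset Printing Implicit Defensive.

Import Order.TTheory GRing.Theory Num.Theory.
Import numFieldNormedType.Exports.
Local Open Scope ring_scope.

(* Layers are numbered from 0: with d 0, ..., d N standing for
   d_1, ..., d_{N+1}, the component of index i is the matrix W_{i+1}. *)
Definition weights (R : realType) (N : nat) (d : nat -> nat) : Type :=
  {dffun forall i : 'I_N, 'M[R]_(d i, d i.+1)}.

Section WeightsLmodule.
Context {R : realType} {N : nat} {d : nat -> nat}.
Local Notation T := (weights R N d).

HB.instance Definition _ := Choice.on T.

Definition weights_of (F : forall i : 'I_N, 'M[R]_(d i, d i.+1)) : T :=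
  [ffun i => F i].

Definition weights_zero : T := weights_of (fun=> 0).
Definition weights_opp (W : T) : T := weights_of (fun i => - W i).
Definition weights_add (U W : T) : T := weights_of (fun i => U i + W i).
Definition weights_scale (a : R) (W : T) : T := weights_of (fun i => a *: W i).

Let addA : associative weights_add.
Proof. by move=> U V W; apply/ffunP => i; rewrite !ffunE addrA. Qed.
Let addC : commutative weights_add.
Proof. by move=> U V; apply/ffunP => i; rewrite !ffunE addrC. Qed.
Let add0 : left_id weights_zero weights_add.
Proof. by move=> U; apply/ffunP => i; rewrite !ffunE add0r. Qed.
Let addN : left_inverse weights_zero weights_opp weights_add.
Proof. by move=> U; apply/ffunP => i; rewrite !ffunE addNr. Qed.

HB.instance Definition _ := GRing.isZmodule.Build T addA addC add0 addN.

Let scaleA (a b : R) (W : T) :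
  weights_scale a (weights_scale b W) = weights_scale (a * b) W.
Proof. by apply/ffunP => i; rewrite !ffunE scalerA. Qed.
Let scale1 : left_id 1 weights_scale.
Proof. by move=> W; apply/ffunP => i; rewrite !ffunE scale1r. Qed.
Let scaleDr : right_distributive weights_scale +%R.
Proof. by move=> a U W; apply/ffunP => i; rewrite !ffunE scalerDr. Qed.
Let scaleDl (W : T) : {morph weights_scale^~ W : a b / a + b}.
Proof. by move=> a b; apply/ffunP => i; rewrite !ffunE scalerDl. Qed.

HB.instance Definition _ :=
  GRing.Zmodule_isLmodule.Build R T scaleA scale1 scaleDr scaleDl.

End WeightsLmodule.

(* The library norm on matrices is the sup norm, hence these definitions. *)
Definition fdot (R : realType) m n (A B : 'M[R]_(m, n)) : R :=
  \sum_i \sum_j A i j * B i j.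
Definition fnorm (R : realType) m n (A : 'M[R]_(m, n)) : R :=
  Num.sqrt (fdot A A).

Section Weights.
Variables (R : realType) (N : nat) (d : nat -> nat).
Implicit Types (U V W P : weights R N d) (F : weights R N d -> R).

Definition wdot U V : R := \sum_(i < N) fdot (U i) (V i).
Definition wnorm W : R := Num.sqrt (\sum_(i < N) fnorm (W i) ^+ 2).

Definition replace_layer W (i : 'I_N) (A : 'M[R]_(d i, d i.+1)) :
    weights R N d :=
  weights_of (dfwith (fun j => W j) A).

(* The i-th component is the matrix of partial derivatives of F with respect
   to the entries of the i-th layer. *)
Definition grad F W : weights R N d :=
  weights_of (fun i => \matrix_(a, b)
    derive (fun A : 'M[R]_(d i, d i.+1) => F (replace_layer W A) : R^o)
           (W i) (delta_mx a b)).

Definition bregman (h : weights R N d -> R) U W : R :=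
  h U - h W - wdot (grad h W) (U - W).

Definition strongly_convex (sigma : R) (h : weights R N d -> R) : Prop :=
  forall U V (t : R), 0 <= t <= 1 ->
    h (t *: U + (1 - t) *: V) <=
    t * h U + (1 - t) * h V - sigma / 2 * t * (1 - t) * wnorm (U - V) ^+ 2.

Definition argmin F : set (weights R N d) :=
  [set U | forall V, F U <= F V]%classic.

Definition bpg_map (f g h : weights R N d -> R) (lambda : R) W :
    set (weights R N d) :=
  argmin (fun U => f U + wdot (grad g W) U + lambda^-1 * bregman h U W).

(* Iterates are numbered from 1; the value at 0 is irrelevant. *)
Definition bpg_sequence (f g h : weights R N d -> R) (lambda : R)
    (W : nat -> weights R N d) : Prop :=
  forall k, (1 <= k)%N -> bpg_map f g h lambda (W k) (W k.+1).

Definition ridge (lambda0 : R) W : R :=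
  lambda0 / 2 * \sum_(i < N) fnorm (W i) ^+ 2.

(* The matrix multiplying -r in the update, taken to be 0 when P = 0. *)
Definition bpg_direction P (i : 'I_N) : 'M[R]_(d i, d i.+1) :=
  if wnorm P == 0 then 0 else (Num.sqrt N%:R / wnorm P) *: P i.

Definition H1 W : R := (wnorm W ^+ 2 / N%:R) ^+ N.
(* H2 is only used for N even and H3 for N odd, so that halving is exact in
   their exponents; likewise for c2 and c3 below. *)
Definition H2 W : R := (wnorm W ^+ 2 / N%:R) ^+ N./2.
Definition H3 W : R := ((wnorm W ^+ 2 + 1) / N.+1%:R) ^+ N.+1./2.
Definition H4 W : R := wnorm W ^+ 2 / N%:R.

End Weights.

Fixpoint layers_mul (R : realType) (n N : nat) : forall d : nat -> nat,
    weights R N d -> 'M[R]_(d N, n) -> 'M[R]_(d 0%N, n) :=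
  match N with
  | 0 => fun d _ X => X
  | N'.+1 => fun d W X =>
      W ord0 *m layers_mul (d := fun i => d i.+1)
        (weights_of (fun i : 'I_N' => W (lift ord0 i))) X
  end.

Section Network.
Variables (R : realType) (N : nat) (d : nat -> nat) (nT : nat).
Variables (X : 'M[R]_(d N, nT)) (Y : 'M[R]_(d 0%N, nT)).

Definition loss (W : weights R N d) : R :=
  fnorm (layers_mul W X - Y) ^+ 2 / 2.

Definition c1 : R :=
  (2 * N%:R - 1) * N%:R ^+ N / (2 * N`!%:R) * fnorm X ^+ 2.
Definition c2 : R :=
  fnorm Y * fnorm X * (N%:R - 1) * N%:R ^+ (N - 2)./2
  / (N%:R - 2) ^+ (N - 2)./2.
Definition c3 : R :=
  fnorm Y * fnorm X * (N%:R - 1) * (N%:R + 1) ^+ (N - 1)./2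
  / (N%:R - 1) ^+ (N - 1)./2.

Definition kernel (rho : R) (W : weights R N d) : R :=
  if N == 2%N then c1 * H1 W + c2 * H2 W
  else if odd N then c1 * H1 W + c3 * H3 W + rho * H4 W
  else c1 * H1 W + c2 * H2 W + rho * H4 W.

End Network.

(* Main.v *)
Require Import Defs.
From mathcomp Require Import all_boot all_order all_algebra.
From mathcomp Require Import boolp classical_sets functions reals.
From mathcomp Require Import topology normedtype derive convex.
From mathcomp Require Import ring lra zify.

Import Order.TTheory GRing.Theory Num.Theory.
Import numFieldNormedType.Exports.
Local Open Scope ring_scope.

(** After multiplication by [lambda] and removal of the terms that do not
    depend on the unknown, the subproblem solved at each iteration
    ([bpg_map_argmin]) is the minimization of
      [h V + lambda * f V + <P, V>],
    and [h + lambda f] depends on [V] only through [s = |V|^2 / N]: it equals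
    [Phi s] for an explicit polynomial [Phi].

    No closed form of the argmin has to be guessed.  The objective is
    polynomial along every line through a minimizer [U], so its derivative
    there vanishes in every direction; this reads
      [P = - (2 / N) Phi'(|U|^2 / N) U]   ([radial_stationary]).
    As [Phi' > 0] on the nonnegative half-line, [U] is a nonpositive multiple
    of [P].  Put [r = |U| / sqrt N].  Taking norms in the stationarity identity
    gives
      [(2 / N) r Phi'(r^2) = |P| / sqrt N],
    and substituting back gives [U = - r sqrt N P / |P|]; if [P = 0], then
    [U = 0] and [r = 0] by the same identity ([radial_argmin]).

    For all three kernels [Phi] has the shape
      [p s^N + q (a s + b)^(m+1) + kappa s]
    with [p, q, a, b >= 0] and [kappa >= N lambda lambda0 / 2 > 0].  Hence
    [Phi'] is positive and nondecreasing for [s >= 0], [r Phi'(r^2)] is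
    strictly increasing for [r >= 0], and the nonnegative root is unique. *)

(** * The Frobenius inner product on families of layers *)

Section FrobeniusInnerProduct.
Context {R : realType} {N : nat} {d : nat -> nat}.
Implicit Types U V W P : weights R N d.

Lemma wdotC U V : wdot U V = wdot V U.
Proof.
apply: eq_bigr => i _; apply: eq_bigr => a _; apply: eq_bigr => b _.
exact: mulrC.
Qed.

Lemma wdotDr P U V : wdot P (U + V) = wdot P U + wdot P V.
Proof.
rewrite /wdot -big_split; apply: eq_bigr => i _ /=.
rewrite /fdot -big_split; apply: eq_bigr => a _ /=.
rewrite -big_split; apply: eq_bigr => b _ /=.
by rewrite ffunE mxE mulrDr.
Qed.

Lemma wdotZr P c U : wdot P (c *: U) = c * wdot P U.
Proof.
rewrite /wdot mulr_sumr; apply: eq_bigr => i _.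
rewrite /fdot mulr_sumr; apply: eq_bigr => a _.
rewrite mulr_sumr; apply: eq_bigr => b _.
by rewrite ffunE mxE mulrCA.
Qed.

Lemma wdotBr P U V : wdot P (U - V) = wdot P U - wdot P V.
Proof. by rewrite -scaleN1r wdotDr wdotZr mulN1r. Qed.

Lemma wdotDl P U V : wdot (U + V) P = wdot U P + wdot V P.
Proof. by rewrite wdotC wdotDr !(wdotC P). Qed.

Lemma wdotZl P c U : wdot (c *: U) P = c * wdot U P.
Proof. by rewrite wdotC wdotZr (wdotC P). Qed.

Lemma wdotBl P U V : wdot (U - V) P = wdot U P - wdot V P.
Proof. by rewrite wdotC wdotBr !(wdotC P). Qed.

Lemma fdot_ge0 m n (A : 'M[R]_(m, n)) : 0 <= fdot A A.
Proof.
by apply: sumr_ge0 => a _; apply: sumr_ge0 => b _; rewrite -expr2 sqr_ge0.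
Qed.

Lemma wdot_ge0 U : 0 <= wdot U U.
Proof. by apply: sumr_ge0 => i _; exact: fdot_ge0. Qed.

Lemma wdot_eq0 U : wdot U U = 0 -> U = 0.
Proof.
move=> /eqP; rewrite psumr_eq0; last by move=> i _; exact: fdot_ge0.
move=> /allP U0; apply/ffunP => i; apply/matrixP => a b.
have /eqP := U0 i (mem_index_enum _); rewrite /fdot pair_big /=.
move=> /eqP; rewrite psumr_eq0; last by move=> j _; rewrite -expr2 sqr_ge0.
move=> /allP /(_ (a, b) (mem_index_enum _)) /=.
by rewrite -expr2 sqrf_eq0 => /eqP ->; rewrite ffunE mxE.
Qed.

Lemma wnorm_sum_sqr U : \sum_(i < N) fnorm (U i) ^+ 2 = wdot U U.
Proof. by apply: eq_bigr => i _; rewrite sqr_sqrtr // fdot_ge0. Qed.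

Lemma wnormE U : wnorm U = Num.sqrt (wdot U U).
Proof. by rewrite /wnorm wnorm_sum_sqr. Qed.

Lemma wnorm_sqr U : wnorm U ^+ 2 = wdot U U.
Proof. by rewrite wnormE sqr_sqrtr // wdot_ge0. Qed.

Lemma wnorm_ge0 U : 0 <= wnorm U.
Proof. by rewrite wnormE sqrtr_ge0. Qed.

Lemma wnorm_eq0 U : (wnorm U == 0) = (U == 0).
Proof.
apply/eqP/eqP => [U0|->]; last first.
  by rewrite wnormE -(scale0r (0 : weights R N d)) wdotZr mul0r sqrtr0.
by apply: wdot_eq0; rewrite -wnorm_sqr U0 expr0n.
Qed.

Lemma wnormZ c U : wnorm (c *: U) = `|c| * wnorm U.
Proof.
by rewrite !wnormE wdotZr wdotZl mulrA -expr2 sqrtrM ?sqr_ge0 // sqrtr_sqr.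
Qed.

End FrobeniusInnerProduct.

(** * Minimizers of a radial function plus a linear form *)

Lemma deriv_horner_argmin (R : realType) (q : {poly R}) (x : R) :
  (forall t, q.[x] <= q.[t]) -> q^`().[x] = 0.
Proof.
move=> qmin; rewrite derivE derive1E.
have qx0 : is_derive x 1 (horner q) 0.
  apply: (@derive1_at_min _ _ (x - 1) (x + 1)) => //; first lra.
  by rewrite in_itv /=; apply/andP; split; lra.
by rewrite derive_val.
Qed.

Section RadialMinimization.
Context {R : realType} {N : nat} {d : nat -> nat}.
Hypothesis N_gt0 : (0 < N)%N.
Variable Phi : {poly R}.
Implicit Types U V P : weights R N d.

Let nu : R := N%:R.
Let nu_gt0 : 0 < nu. Proof. by rewrite ltr0n. Qed.

(** The directional derivative of the objective at [U] along [V] is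
    [<k U + P, V>], where [k] is [2 / N] times the slope of [Phi]; it vanishes
    for every [V], in particular for [V = k U + P]. *)
Lemma radial_stationary P U :
  argmin (fun V => Phi.[wnorm V ^+ 2 / N%:R] + wdot P V) U ->
  P = - (2 / N%:R * Phi^`().[wnorm U ^+ 2 / N%:R]) *: U.
Proof.
move=> Umin; set k := 2 / _ * _.
suff /wdot_eq0 /eqP : wdot (k *: U + P) (k *: U + P) = 0.
  by rewrite addrC addr_eq0 scaleNr => /eqP.
set V := _ + P.
(* [s] and [q] are the values at [U + t V] of [|.|^2 / N] and of the objective,
   as polynomials in [t]. *)
pose s : {poly R} := nu^-1 *: ((wdot U U)%:P + (2 * wdot U V) *: 'X
                               + wdot V V *: 'X^2).
pose q : {poly R} := (Phi \Po s) + (wdot P U)%:P + wdot P V *: 'X.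
have sE t : s.[t] = wnorm (U + t *: V) ^+ 2 / N%:R.
  rewrite wnorm_sqr wdotDr !wdotDl !wdotZr !wdotZl (wdotC V U) !hornerE /=.
  by rewrite -/nu; ring.
have qE t : q.[t] = Phi.[wnorm (U + t *: V) ^+ 2 / N%:R] + wdot P (U + t *: V).
  by rewrite /q !hornerE horner_comp sE wdotDr wdotZr; ring.
have : q^`().[0] = 0.
  apply: deriv_horner_argmin => t.
  by rewrite !qE scale0r addr0; exact: Umin.
have -> : q^`().[0] = wdot V V; last by [].
rewrite /q !poly.derivE deriv_comp /s !poly.derivE -/s !hornerE horner_comp sE.
rewrite scale0r addr0 {3}/V wdotDl wdotZl /k -/nu /=.
by ring.
Qed.

Hypothesis Phi_slope : forall s t : R, 0 <= s -> s <= t ->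
  0 < Phi^`().[s] <= Phi^`().[t].

Lemma radial_equation_inj (x y : R) : 0 <= x -> 0 <= y ->
  x * Phi^`().[x ^+ 2] = y * Phi^`().[y ^+ 2] -> x = y.
Proof.
wlog lexy : x y / x <= y => [hw x0 y0 e|x0 y0 e].
  by case/orP: (le_total x y) => h; [|symmetry]; apply: hw.
apply/eqP; rewrite eq_le lexy /= leNgt; apply/negP => ltxy.
have /andP[p1 p2] := Phi_slope _ _ (sqr_ge0 x) (lerXn2r 2 x0 y0 lexy).
have : x * Phi^`().[x ^+ 2] < y * Phi^`().[y ^+ 2].
  apply: (@lt_le_trans _ _ (y * Phi^`().[x ^+ 2])).
    by rewrite ltr_pM2r.
  by rewrite ler_wpM2l.
by rewrite e ltxx.
Qed.

(** The root is [r = |U| / sqrt N].  The equation is passed as a function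
    [eqn], constrained only on [r >= 0], so that it can be instantiated with
    any written form of the root equation. *)
Lemma radial_argmin P U (eqn : R -> R) :
  (forall r, 0 <= r ->
     eqn r = 2 / N%:R * (r * Phi^`().[r ^+ 2]) - wnorm P / Num.sqrt N%:R) ->
  argmin (fun V => Phi.[wnorm V ^+ 2 / N%:R] + wdot P V) U ->
  exists2 r : R, unique (fun r => 0 <= r /\ eqn r = 0) r
    & forall i, U i = - r *: bpg_direction P i.
Proof.
move=> eqnE /(radial_stationary _ _) PE.
have sqrtN_gt0 : 0 < Num.sqrt nu by rewrite sqrtr_gt0.
have sqrtN_neq0 := lt0r_neq0 sqrtN_gt0.
pose r := wnorm U / Num.sqrt nu.
have r_ge0 : 0 <= r by rewrite divr_ge0 ?wnorm_ge0 ?sqrtr_ge0.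
have r2E : wnorm U ^+ 2 / N%:R = r ^+ 2.
  by rewrite /r expr_div_n (sqr_sqrtr (ltW nu_gt0)).
move: PE; rewrite r2E => PE.
have /andP[slope_gt0 _] := Phi_slope _ _ (sqr_ge0 r) (lexx _).
set k := 2 / N%:R * _ in PE.
have k_gt0 : 0 < k by rewrite mulr_gt0 // divr_gt0.
have normP : wnorm P = k * wnorm U by rewrite PE wnormZ normrN gtr0_norm.
have r_root : eqn r = 0.
  rewrite eqnE // normP mulrCA -/nu /k -/nu /r; field.
  by rewrite sqrtN_neq0 lt0r_neq0.
exists r.
  split=> // x [x_ge0]; rewrite eqnE // -{}r_root eqnE //.
  move=> /addIr /mulfI e; apply: radial_equation_inj => //; apply/esym/e.
  by rewrite mulf_neq0 ?invr_neq0 ?lt0r_neq0.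
move=> i; rewrite /bpg_direction wnorm_eq0; case: eqP => [P0|/eqP P_neq0].
  move/eqP: normP; rewrite P0 (eqP (_ : wnorm 0 == 0)) ?wnorm_eq0 //.
  rewrite eq_sym mulf_eq0 gt_eqF //= wnorm_eq0 => /eqP ->.
  by rewrite scaler0 ffunE.
have nU_neq0 : wnorm U != 0.
  by apply: contra P_neq0 => /eqP U0; rewrite -wnorm_eq0 normP U0 mulr0.
rewrite PE wnormZ normrN gtr0_norm // ffunE !scalerA -[LHS]scale1r.
congr (_ *: _); rewrite /r -/nu; field.
by rewrite nU_neq0 sqrtN_neq0 lt0r_neq0.
Qed.

End RadialMinimization.

(** * Reduction of the Bregman proximal step *)

(** [lambda] times the proximal objective differs from the one below by
    [- h W + <grad h W, W>], which does not depend on the unknown. *)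
Lemma bpg_map_argmin (R : realType) (N : nat) (d : nat -> nat)
    (f g h : weights R N d -> R) (lambda : R) (W U : weights R N d) :
  0 < lambda -> bpg_map f g h lambda W U ->
  argmin (fun V => h V + lambda * f V
                   + wdot (lambda *: grad g W - grad h W) V) U.
Proof.
move=> lambda_gt0 Umin V; have := Umin V.
rewrite -(ler_pM2l lambda_gt0) /bregman !wdotBr !wdotBl !wdotZl.
rewrite !mulrDr !(mulrA lambda lambda^-1) divff ?lt0r_neq0 // !mul1r.
lra.
Qed.

(** * The radial profile of the kernels *)

Section KernelProfile.
Context {R : realType}.
Implicit Types (p q a b kappa : R) (m n : nat).

(** The common shape of [h + lambda f] as a function of [s = |V|^2 / N]: the
    middle term is [H2] for [a = 1] and [b = 0], and [H3] for [a = N / (N + 1)]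
    and [b = 1 / (N + 1)].  The exponents are successors so that derivatives
    need no truncated subtraction. *)
Definition profile p n q m a b kappa : {poly R} :=
  p *: 'X^(n.+1) + q *: (a *: 'X + b%:P) ^+ m.+1 + kappa *: 'X.

Lemma horner_profile p n q m a b kappa s :
  (profile p n q m a b kappa).[s] =
  p * s ^+ n.+1 + q * (a * s + b) ^+ m.+1 + kappa * s.
Proof. by rewrite !hornerE. Qed.

Lemma deriv_profile p n q m a b kappa s :
  (profile p n q m a b kappa)^`().[s] =
  p * n.+1%:R * s ^+ n + q * a * m.+1%:R * (a * s + b) ^+ m + kappa.
Proof.
rewrite /profile !poly.derivE deriv_exp !poly.derivE.
by rewrite !(hornerE, hornerMn) /=; ring.
Qed.

Lemma deriv_profile_slope p n q m a b kappa :
  0 <= p -> 0 <= q -> 0 <= a -> 0 <= b -> 0 < kappa ->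
  forall s t : R, 0 <= s -> s <= t ->
  0 < (profile p n q m a b kappa)^`().[s]
    <= (profile p n q m a b kappa)^`().[t].
Proof.
move=> p0 q0 a0 b0 k0 s t s0 st; rewrite !deriv_profile.
have as0 : 0 <= a * s + b by rewrite addr_ge0 ?mulr_ge0.
have ast : a * s + b <= a * t + b by rewrite lerD2r ler_wpM2l.
apply/andP; split.
  by rewrite ltr_wpDl // addr_ge0 // !mulr_ge0 ?exprn_ge0.
rewrite lerD2r lerD // ler_wpM2l ?mulr_ge0 // lerXn2r //.
  exact: le_trans st.
exact: le_trans ast.
Qed.

End KernelProfile.

Section KernelConstants.
Context {R : realType} {N : nat} {d : nat -> nat} {nT : nat}.
Variables (X : 'M[R]_(d N, nT)) (Y : 'M[R]_(d 0%N, nT)).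
Hypothesis N_ge2 : (2 <= N)%N.

Let N_ge m : (m <= 2)%N -> 0 <= N%:R - m%:R :> R.
Proof. by move=> m2; rewrite subr_ge0 ler_nat (leq_trans m2). Qed.

Lemma c1_ge0 : 0 <= c1 X.
Proof.
rewrite /c1; apply: mulr_ge0; last by rewrite sqr_ge0.
rewrite divr_ge0 ?mulr_ge0 ?exprn_ge0 ?ler0n // subr_ge0 -natrM ler1n.
by lia.
Qed.

Lemma c2_ge0 : 0 <= c2 X Y.
Proof.
by rewrite /c2 divr_ge0 ?mulr_ge0 ?exprn_ge0 ?sqrtr_ge0 ?N_ge ?(N_ge 1).
Qed.

Lemma c3_ge0 : 0 <= c3 X Y.
Proof.
rewrite /c3 divr_ge0 ?mulr_ge0 ?exprn_ge0 ?sqrtr_ge0 ?(N_ge 1) //.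
by rewrite addr_ge0.
Qed.

End KernelConstants.

Lemma double_predn n : (0 < n)%N -> (2 * n - 1 = (2 * n.-1).+1)%N.
Proof. lia. Qed.

(** The update for every kernel with such a profile.  The ridge term adds
    [N lambda lambda0 / 2] to the linear coefficient [mu], since
    [lambda lambda0 / 2 |V|^2 = (N lambda lambda0 / 2) s]; this makes the
    linear coefficient positive even when [mu = 0]. *)
Lemma ridge_kernel_update (R : realType) (N : nat) (d : nat -> nat)
    (h : weights R N d -> R) (P U : weights R N d)
    (p q a b mu lambda lambda0 : R) (m : nat) (eqn : R -> R) :
  (0 < N)%N -> 0 <= p -> 0 <= q -> 0 <= a -> 0 <= b -> 0 <= mu ->
  0 < lambda * lambda0 ->
  (forall V, h V = p * H1 V + q * (a * (wnorm V ^+ 2 / N%:R) + b) ^+ m.+1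
                   + mu * H4 V) ->
  (forall r, eqn r =
     2 * p * r ^+ (2 * N - 1)
     + 2 / N%:R * q * a * m.+1%:R * (a * r ^+ 2 + b) ^+ m * r
     + (2 * mu / N%:R + lambda * lambda0) * r
     - wnorm P / Num.sqrt N%:R) ->
  argmin (fun V => h V + lambda * ridge lambda0 V + wdot P V) U ->
  exists2 r : R, unique (fun r => 0 <= r /\ eqn r = 0) r
    & forall i, U i = - r *: bpg_direction P i.
Proof.
move=> N_gt0 p0 q0 a0 b0 mu0 ll_gt0 hE eqnE Umin.
have nu_gt0 : 0 < N%:R :> R by rewrite ltr0n.
have nu_neq0 := lt0r_neq0 nu_gt0.
pose Phi := profile p N.-1 q m a b (mu + N%:R / 2 * (lambda * lambda0)).
apply: (@radial_argmin _ _ _ N_gt0 Phi).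
- apply: deriv_profile_slope => //.
  by rewrite ltr_wpDl // mulr_gt0 // divr_gt0.
- move=> r r0; rewrite eqnE // deriv_profile prednK //.
  rewrite double_predn // exprS exprM.
  (* The powers become atoms, so that only rational arithmetic is left. *)
  move: ((r ^+ 2) ^+ _) ((a * _ + b) ^+ _) (wnorm P / _) => x y z.
  by field.
move=> V; have := Umin V; rewrite /ridge !hE !wnorm_sum_sqr.
rewrite !horner_profile prednK // -!wnorm_sqr /H1 /H4.
have ridgeE x :
    lambda * (lambda0 / 2 * x) = N%:R / 2 * (lambda * lambda0) * (x / N%:R).
  by field.
by rewrite !ridgeE; lra.
Qed.

(** * The update formula *)

Theorem proposition21 (R : realType) (N : nat) (d : nat -> nat) (nT : nat)
    (X : 'M[R]_(d N, nT)) (Y : 'M[R]_(d 0%N, nT))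
    (rho sigma L lambda lambda0 : R) (W : nat -> weights R N d) :
  (2 <= N)%N ->
  (forall i, (i <= N)%N -> (0 < d i)%N) ->
  (0 < nT)%N ->
  (~~ odd N -> (2 < N)%N -> 0 < rho) ->
  (odd N -> 0 <= rho) ->
  0 < lambda0 ->
  let f := ridge lambda0 in
  let g := loss X Y in
  let h := kernel X Y rho in
  0 < sigma -> strongly_convex sigma h ->
  0 < L ->
  convex_function setT (fun U : weights R N d => L * h U - g U) ->
  convex_function setT (fun U : weights R N d => L * h U + g U) ->
  0 < lambda -> lambda < 1 / L ->
  bpg_sequence f g h lambda W ->
  forall k, (1 <= k)%N ->
  let P := lambda *: grad g (W k) - grad h (W k) in
  [/\ N = 2%N ->
      exists2 r : R,
        unique (fun r => 0 <= r /\
          2 * c1 X * r ^+ 3 + (c2 X Y + lambda * lambda0) * r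
          - wnorm P / Num.sqrt 2 = 0) r
        & forall i, W k.+1 i = - r *: bpg_direction P i,
      (2 < N)%N -> ~~ odd N ->
      exists2 r : R,
        unique (fun r => 0 <= r /\
          2 * c1 X * r ^+ (2 * N - 1) + c2 X Y * r ^+ (N - 1)
          + (2 * rho / N%:R + lambda * lambda0) * r
          - wnorm P / Num.sqrt N%:R = 0) r
        & forall i, W k.+1 i = - r *: bpg_direction P i
    & (2 < N)%N -> odd N ->
      exists2 r : R,
        unique (fun r => 0 <= r /\
          2 * c1 X * r ^+ (2 * N - 1)
          + c3 X Y * ((N%:R * r ^+ 2 + 1) / (N%:R + 1)) ^+ (N - 1)./2 * r
          + (2 * rho / N%:R + lambda * lambda0) * r
          - wnorm P / Num.sqrt N%:R = 0) r
        & forall i, W k.+1 i = - r *: bpg_direction P i].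
Proof.
move=> N_ge2 _ _ rho_even rho_odd lambda0_gt0 f g h _ _ _ _ _ lambda_gt0 _.
move=> bpgW k k_ge1 P.
have Umin := bpg_map_argmin _ _ _ _ _ _ _ _ _ lambda_gt0 (bpgW k k_ge1).
rewrite -/P in Umin; move: {bpgW k_ge1} (W k.+1) P Umin => U P Umin.
have N_gt0 : (0 < N)%N by exact: leq_trans N_ge2.
have nu_neq0 : N%:R != 0 :> R by rewrite pnatr_eq0 -lt0n.
have ll_gt0 : 0 < lambda * lambda0 by rewrite mulr_gt0.
have c1_ge0 := c1_ge0 X N_ge2.
have c2_ge0 := c2_ge0 X Y N_ge2.
have c3_ge0 := c3_ge0 X Y N_ge2.
split.
- move=> N2; subst N.
  (* The exponent of [H2] is 1, so its term is the linear one with [m = 0]. *)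
  apply: (@ridge_kernel_update _ _ _ h P U
            (c1 X) (c2 X Y) 1 0 0 lambda lambda0 0) => // [V|r].
  + by rewrite /h /kernel eqxx /H1 /H2 expr1; ring.
  + by move: (wnorm P / _) => z; rewrite expr0 /=; field.
- move=> N_gt2 N_even; have rho_gt0 := rho_even N_even N_gt2.
  have [m [halfN predN natN]] : exists m,
      [/\ N./2 = m.+1, (N - 1 = (2 * m).+1)%N & (N = 2 * m.+1)%N].
    by exists N./2.-1; split; move: N_even N_gt2; clear; lia.
  apply: (@ridge_kernel_update _ _ _ h P U
            (c1 X) (c2 X Y) 1 0 rho lambda lambda0 m) => // [|V|r].
  + exact: ltW.
  + by rewrite /h /kernel gtn_eqF // (negPf N_even) /H2 halfN mul1r addr0.
  + (* [(2 / N) (m + 1) = 1], so the coefficient [c2] is left unchanged. *)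
    rewrite predN exprS exprM !mul1r addr0 mulr1.
    have NE : N%:R = 2 * m.+1%:R :> R by rewrite [in LHS]natN natrM.
    have M_neq0 : m.+1%:R != 0 :> R by rewrite pnatr_eq0.
    move: ((r ^+ 2) ^+ m) (r ^+ (2 * N - 1)) (wnorm P / _) => x y z.
    by rewrite NE; move: (m.+1%:R : R) M_neq0 => M M_neq0; field.
- move=> N_gt2 N_odd; have rho_ge0 := rho_odd N_odd.
  have [m [halfN halfpredN natN]] : exists m,
      [/\ N.+1./2 = m.+1, ((N - 1)./2 = m)%N & (N.+1 = 2 * m.+1)%N].
    by exists (N - 1)./2; split; move: N_odd N_gt2; clear; lia.
  have N1_neq0 : N%:R + 1 != 0 :> R by rewrite natr1 pnatr_eq0.
  apply: (@ridge_kernel_update _ _ _ h P U (c1 X) (c3 X Y)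
            (N%:R / (N%:R + 1)) (1 / (N%:R + 1)) rho lambda lambda0 m)
    => // [||V|r].
  + by rewrite divr_ge0 ?addr_ge0.
  + by rewrite divr_ge0 ?addr_ge0.
  + rewrite /h /kernel gtn_eqF // N_odd /H3 halfN -natr1.
    congr (_ + _ * _ ^+ _ + _); move: (wnorm V ^+ 2) => x.
    by field; rewrite N1_neq0 nu_neq0.
  + (* [(2 / N) (N / (N + 1)) (m + 1) = 1], which leaves [c3] unchanged. *)
    rewrite halfpredN.
    have -> : N%:R / (N%:R + 1) * r ^+ 2 + 1 / (N%:R + 1)
              = (N%:R * r ^+ 2 + 1) / (N%:R + 1) by field.
    have NE : m.+1%:R = (N%:R + 1) / 2 :> R
      by rewrite natr1 natN natrM; field.
    rewrite NE; move: (_ ^+ m) (r ^+ (2 * N - 1)) (wnorm P / _) => x y z.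
    by field; rewrite N1_neq0 nu_neq0.
Qed.
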